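(* Let $X$ be a Banach space and $Z=X^*$. a) Let $\mathcal{E}$ be a linear subspace of $Z$ weak*-homeomorphic to $\ell^\infty$ via a linear map $T:\ell^\infty\to\mathcal{E}$. Then (i) there exists a bounded $\ell^\infty$-interpolating sequence $K=(k_j)_j$ in $X$ such that $R_KT=I_{\ell^\infty}$ (and $V_K$ is bounded below); (ii) the space $\mathcal{E}$ is weak*-complemented in $Z$, and $X_K$ is (norm-)complemented in $X$. b) Conversely, if $K=(k_j)_j$ is an $\ell^\infty$-interpolating sequence in $X$ such that $X_K$ is complemented in $X$, say $X=X_K\oplus Y$ (topological direct sum), then $Y^\perp$ is weak*-homeomorphic to $\ell^\infty$.
   Context: For a bounded sequence $K=(k_j)_j$ in $X$, $R_K:Z\to\ell^\infty$ is the map $R_K(h)=(\langle k_j,h\rangle)_j$, and $V_K:\ell^1\to X$ is the bounded linear map $V_K(\gamma)=\sum_n\gamma_nk_n$ (so $V_K^*=R_K$). $X_K$ denotes the norm closure of the range of $V_K$. $K$ is called an $\ell^\infty$-interpolating sequence if $R_K$ is onto (equivalently, $V_K$ is bounded below). The weak* topologies are those of $Z=X^*$ and $\ell^\infty=(\ell^1)^*$; subspaces of $Z$ carry the relative weak* topology, and weak*-homeomorphisms are understood to be linear. A subspace of $Z$ is weak*-complemented if it is the range of a weak*-continuous linear projection on $Z$; a subspace of $X$ is (norm-)complemented if it is the range of a bounded linear projection on $X$. $Y^\perp=\{h\in Z:\langle y,h\rangle=0\ \forall y\in Y\}$. *)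

(* Defs.v *)
From HB Require Import structures.
From mathcomp Require Import all_boot all_order all_algebra.
From mathcomp Require Import all_classical all_reals all_analysis.
From mathcomp Require Import complex.

Set Implicit Arguments.
Unset Strict Implicit.
Unset Printing Implicit Defensive.

Import Order.TTheory GRing.Theory Num.Theory.
Import numFieldNormedType.Exports.

Local Open Scope classical_set_scope.
Local Open Scope ring_scope.

(* Banach spaces are taken over either the real or the complex numbers. *)
Variant base := RealScalars | ComplexScalars.

Definition scalar_field (R : realType) (b : base) : numFieldType :=
  match b with
  | RealScalars => R
  | ComplexScalars => (R[i] : numFieldType)
  end.

Lemma bounded_seqE (F : numFieldType) (V : normedModType F) (k : nat -> V) :
  bounded_fun k <-> exists M, forall j, `|k j| <= M.
Proof.
have PF : ProperFilter (globally [set: nat]).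
  exact: (@globally_properfilter _ _ 0%N).
split=> [/(ex_bound k)[M hM]|[M hM]]; first by exists M => j; exact: hM.
by apply/(ex_bound k); exists M => j _; exact: hM.
Qed.

Section BoundedSequences.
Context {F : numFieldType} (V : normedModType F).

Definition is_bounded_seq : {pred nat -> V} :=
  fun k => `[< bounded_fun k >].

Lemma is_bounded_seqP (k : nat -> V) :
  reflect (exists M, forall j, `|k j| <= M) (k \in is_bounded_seq).
Proof. by apply: (iffP (asboolP _)) => /bounded_seqE. Qed.

Lemma is_bounded_seq_submod : submod_closed is_bounded_seq.
Proof.
split=> [|c k l /is_bounded_seqP[M kM] /is_bounded_seqP[N lN]].
  by apply/is_bounded_seqP; exists 0 => j; rewrite normr0.
apply/is_bounded_seqP; exists (`|c| * M + N) => j.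
by rewrite (le_trans (ler_normD _ _))// lerD// normrZ ler_wpM2l.
Qed.

HB.instance Definition _ :=
  GRing.isSubmodClosed.Build _ _ is_bounded_seq is_bounded_seq_submod.

Record bounded_seq := BoundedSeq {
  bounded_seq_val :> nat -> V;
  _ : bounded_seq_val \in is_bounded_seq }.

HB.instance Definition _ := [isSub for bounded_seq_val].
HB.instance Definition _ := [Choice of bounded_seq by <:].
HB.instance Definition _ := [SubChoice_isSubLmodule of bounded_seq by <:].

End BoundedSequences.

Section Ell1.
Context (F : numFieldType).

(* Over the real or complex numbers, [\sum_n `|g n|] converges iff its partial
   sums are bounded; the latter is a subspace over any [numFieldType]. *)
Definition is_summable : {pred nat -> F^o} :=
  fun g => `[< bounded_fun (series (fun n => `|g n|) : nat -> F^o) >].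

Lemma is_summableP (g : nat -> F^o) :
  reflect (exists M, forall n, series (fun n => `|g n|) n <= M)
          (g \in is_summable).
Proof.
apply: (iffP (asboolP _)) => [/bounded_seqE[M hM]|[M hM]].
  exists M => n; apply: le_trans (hM n); rewrite /= ger0_norm//.
  by rewrite sumr_ge0.
apply/bounded_seqE; exists M => n /=; rewrite ger0_norm ?hM//.
by rewrite sumr_ge0.
Qed.

Lemma is_summable_submod : submod_closed is_summable.
Proof.
split=> [|c g h /is_summableP[M gM] /is_summableP[N hN]].
  by apply/is_summableP; exists 0 => n; rewrite /series/= big1// => ? _;
    rewrite normr0.
apply/is_summableP; exists (`|c| * M + N) => n.
apply: (@le_trans _ _ (`|c| * series (fun n => `|g n|) n
                       + series (fun n => `|h n|) n)).
  rewrite /series/= mulr_sumr -big_split/=; apply: ler_sum => i _.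
  by rewrite (le_trans (ler_normD _ _))// normrZ.
by rewrite lerD// ler_wpM2l.
Qed.

HB.instance Definition _ :=
  GRing.isSubmodClosed.Build _ _ is_summable is_summable_submod.

Record ell1 := Ell1 {
  ell1_val :> nat -> F^o;
  _ : ell1_val \in is_summable }.

HB.instance Definition _ := [isSub for ell1_val].
HB.instance Definition _ := [Choice of ell1 by <:].
HB.instance Definition _ := [SubChoice_isSubLmodule of ell1 by <:].

Definition ell1_norm (g : ell1) : F := limn (series (fun n => `|g n|)).

End Ell1.

Section EllInfty.
Context (F : numFieldType).

Definition ellinfty := bounded_seq F^o.

Definition ell_pairing (a : ellinfty) (g : ell1 F) : F^o :=
  limn (series (fun n => g n * a n)).

HB.instance Definition _ := GRing.Lmodule.copy ellinfty (bounded_seq F^o).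

(* [ellinfty] carries the weak* topology of the dual of [ell1]. *)
HB.instance Definition _ := Topological.copy ellinfty
  (initial_topology (ell_pairing : ellinfty -> {ptws ell1 F -> F^o})).

End EllInfty.

Section Dual.
Context {F : numFieldType} (X : normedModType F).

Definition is_dual : {pred X -> F^o} :=
  fun f => `[< linear f /\ continuous f >].

Lemma is_dual_submod : submod_closed is_dual.
Proof.
split=> [|c f g /asboolP[lf cf] /asboolP[lg cg]]; apply/asboolP; split.
- by move=> c x y /=; rewrite -[RHS]/(c *: 0 + 0) scaler0 addr0.
- by move=> x; exact: cvg_cst.
- move=> d x y; rewrite -![(_ *: f + g) _]/(c *: f _ + g _) lf lg.
  by rewrite !scalerDr !scalerA (mulrC c) addrACA.
- by move=> x; apply: cvgD; [apply: cvgZr; exact: cf|exact: cg].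
Qed.

HB.instance Definition _ :=
  GRing.isSubmodClosed.Build _ _ is_dual is_dual_submod.

Record dual := Dual {
  dual_val :> X -> F^o;
  _ : dual_val \in is_dual }.

HB.instance Definition _ := [isSub for dual_val].
HB.instance Definition _ := [Choice of dual by <:].
HB.instance Definition _ := [SubChoice_isSubLmodule of dual by <:].

Lemma dual_linear (h : dual) : linear h.
Proof. by have /asboolP[] := valP h. Qed.

HB.instance Definition _ (h : dual) :=
  GRing.isLinear.Build F X F^o *:%R h (dual_linear h).

Lemma dual_continuous (h : dual) : continuous h.
Proof. by have /asboolP[] := valP h. Qed.

(* [dual] carries the weak* topology, not the norm topology. *)
HB.instance Definition _ := Topological.copy dual
  (initial_topology (dual_val : dual -> {ptws X -> F^o})).

End Dual.

Section Operators.
Context {F : numFieldType} {X : normedModType F}.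

Lemma R_op_subproof (k : bounded_seq X) (h : dual X) :
  (fun j => h (k j)) \in is_bounded_seq (V := F^o).
Proof.
have /linear_boundedP/pinfty_ex_gt0[r r0 hr] : bounded_near h (nbhs (0 : X)).
  exact/linear_bounded_continuous/dual_continuous.
have /is_bounded_seqP[M kM] : (k : nat -> X) \in is_bounded_seq (V := X) by exact: (valP k).
apply/is_bounded_seqP; exists (r * M) => j.
by rewrite (le_trans (hr (k j)))// ler_wpM2l// ltW.
Qed.

Definition R_op (k : bounded_seq X) (h : dual X) : ellinfty F :=
  BoundedSeq (R_op_subproof k h).

Definition V_op (k : bounded_seq X) (g : ell1 F) : X :=
  limn (series (fun n => g n *: k n)).

Definition X_sub (k : bounded_seq X) : set X := closure (range (V_op k)).

Definition V_bounded_below (k : bounded_seq X) : Prop :=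
  exists2 c : F, 0 < c & forall g, c * ell1_norm g <= `|V_op k g|.

Definition interpolating (k : bounded_seq X) : Prop :=
  forall a : ellinfty F, exists h : dual X, R_op k h = a.

Definition linear_subspace {W : lmodType F} (E : set W) : Prop :=
  submod_closed (mem E).

Definition bounded_projection (P : {linear X -> X}) : Prop :=
  continuous P /\ forall x, P (P x) = P x.

Definition complemented (A : set X) : Prop :=
  exists2 P : {linear X -> X}, bounded_projection P & range P = A.

(* Algebraic direct sum whose two coordinate maps are continuous. *)
Definition topological_direct_sum (A B : set X) : Prop :=
  [/\ linear_subspace A, linear_subspace B, A `&` B = [set 0] &
      exists p q : X -> X, [/\ continuous p, continuous q &
        forall x, [/\ A (p x), B (q x) & x = p x + q x]]].

Definition weakstar_complemented (E : set (dual X)) : Prop :=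
  exists2 P : {linear dual X -> dual X},
    continuous P /\ (forall h, P (P h) = P h) & range P = E.

Definition weakstar_homeomorphism
    (T : {linear ellinfty F -> dual X}) (E : set (dual X)) : Prop :=
  [/\ continuous T, range T = E &
      exists2 S : dual X -> ellinfty F, cancel T S & {within E, continuous S}].

Definition annihilator (Y : set X) : set (dual X) :=
  [set h | forall y, Y y -> h y = 0].

End Operators.

(* Main.v *)
(** The weak*-continuous functionals on a subspace of a dual space [Z = X^*] are
the evaluations, since weak*-continuity bounds such a functional by finitely many
evaluations and linear algebra does the rest.  Hence [T] is the adjoint of a map
[V : X -> ell^1], and weak*-continuity of the inverse of [T] makes [V] onto.
By the open mapping theorem the unit vectors of [ell^1] have bounded lifts [k_j],
which give [R_K T = 1] and [V V_K = 1]; then [T R_K] and [V_K V] are the required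
projections.  Conversely, if [R_K] is onto, uniform boundedness makes [V_K]
bounded below, so that the projection onto [X_K] along [Y] factors as
[V_K G] for some [G : X -> ell^1]; the adjoint of [G] maps [ell^infty] onto the
annihilator of [Y] with inverse [R_K].

The open mapping, closed graph and uniform boundedness principles are all
obtained from one Baire argument (Zabreiko's lemma).  The scalars, real or
complex, enter only through completeness and the archimedean property. *)

Require Import Defs.
From HB Require Import structures.
From mathcomp Require Import all_boot all_order all_algebra.
From mathcomp Require Import all_classical all_reals all_analysis.
From mathcomp Require Import complex.
From mathcomp Require Import ring.

Set Implicit Arguments.
Unset Strict Implicit.
Unset Printing Implicit Defensive.

Import Order.TTheory GRing.Theory Num.Theory.
Import numFieldNormedType.Exports.
Local Open Scope classical_set_scope.
Local Open Scope ring_scope.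

(** * Limits in complete normed spaces *)

Section Limits.
Context {F : numFieldType}.

Lemma cvgn_distP (V : normedModType F) (u : nat -> V) (l : V) :
  u @ \oo --> l <->
  forall e : F, 0 < e -> exists N, forall n, (N <= n)%N -> `|l - u n| <= e.
Proof.
split=> [/cvgrPdist_le ul e /ul[N _ hN]|ul]; first by exists N.
by apply/cvgrPdist_le => e /ul[N hN]; exists N.
Qed.

Lemma limn_eq (V : normedModType F) (u : nat -> V) (l : V) :
  u @ \oo --> l -> limn u = l.
Proof. by apply: cvg_lim; exact: norm_hausdorff. Qed.

Lemma limit_norm_le (V : normedModType F) (u : nat -> V) (l : V) (M : F) :
  u @ \oo --> l -> (\forall n \near \oo, `|u n| <= M) -> `|l| <= M.
Proof.
move=> /cvgn_distP ul [N _ hN]; apply/ler_addgt0Pr => e /ul[N' hN'].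
pose n := maxn N N'.
rewrite -[l](subrK (u n)) addrC (le_trans (ler_normD _ _))// lerD//.
  by apply: hN; exact: leq_maxl.
by apply: hN'; exact: leq_maxr.
Qed.

(** Completeness as a predicate can be assumed of any normed module, including the scalars [F^o].
    Comparing all late terms with the single term [u N] amounts to the usual Cauchy condition. *)
Definition seq_complete (V : normedModType F) :=
  forall u : nat -> V,
    (forall e : F, 0 < e ->
       exists N, forall n, (N <= n)%N -> `|u n - u N| <= e) ->
    cvgn u.

Lemma complete_seq_complete (V : completeNormedModType F) : seq_complete V.
Proof.
move=> u hu; apply: cauchy_cvg; apply: cauchy_exP => e e0.
have e20 : 0 < e / 2 by rewrite divr_gt0.
have [N hN] := hu _ e20; exists (u N); exists N => // n /hN.
rewrite /= -ball_normE/= distrC => /le_lt_trans; apply.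
by rewrite ltr_pdivrMr// mulr_natr mulr2n ltrDl.
Qed.

Context (archiF : Num.archimedean_axiom F).

(** The archimedean property gives [n] above the quotient of [|c|] by [e], and [2 ^+ n] exceeds [n].
    Here and below, writing the constant as a norm makes it nonnegative for every [c]. *)
Lemma geometric_small (c e : F) : 0 < e -> exists n, `|c| / 2 ^+ n <= e.
Proof.
move=> e0; have [n hn] := archiF (`|c| / e); exists n.
rewrite ler_pdivrMr ?exprn_gt0// mulrC -ler_pdivrMr//.
rewrite ger0_norm ?divr_ge0// ?ltW// in hn.
by rewrite (le_trans (ltW hn))// -natrX ler_nat ltnW// ltn_expl.
Qed.

Lemma le_geometric (x y c : F) :
  (forall n, x <= y + `|c| / 2 ^+ n) -> x <= y.
Proof.
move=> h; apply/ler_addgt0Pr => e /(geometric_small c)[n hn].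
by rewrite (le_trans (h n))// lerD2l.
Qed.

(** Otherwise [G] would jump by at least [e] infinitely often and, by the archimedean property, pass
    [M]. No suprema are taken, so this works in any archimedean [F]. *)
Lemma nondecreasing_bounded_cauchy (G : nat -> F) (M e : F) :
  (forall m n, (m <= n)%N -> G m <= G n) -> 0 <= G 0%N ->
  (forall n, G n <= M) -> 0 < e ->
  exists N, forall n, (N <= n)%N -> G n - G N <= e.
Proof.
move=> Gnd G0 GM e0; apply: contrapT => /forallNP noN.
have G_ge0 n : 0 <= G n by rewrite (le_trans G0)// Gnd.
have step N : exists n, (N <= n)%N /\ G N + e <= G n.
  have /existsNP[n /not_implyP[Nn /negP]] := noN N.
  have dG_real : G n - G N \is Num.real by rewrite ger0_real// subr_ge0 Gnd.
  rewrite -(real_ltNge (gtr0_real e0) dG_real) => /ltW eG.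
  by exists n; rewrite -lerBrDl.
have big k : exists n, e *+ k <= G n.
  elim: k => [|k [n hn]]; first by exists 0%N; rewrite mulr0n.
  have [m [_ hm]] := step n; exists m.
  by rewrite mulrS addrC (le_trans _ hm)// lerD2r.
have M0 : 0 <= M := le_trans G0 (GM 0%N).
have [k] := archiF (M / e).
rewrite ger0_norm ?divr_ge0// ?ltW// ltr_pdivrMr// mulr_natl => Mk.
have [n hn] := big k.
by have := lt_le_trans Mk (le_trans hn (GM n)); rewrite ltxx.
Qed.

Lemma normal_series_cvg (V : normedModType F) (u : nat -> V) (M : F) :
  seq_complete V -> (forall n, \sum_(0 <= i < n) `|u i| <= M) ->
  cvgn (series u).
Proof.
move=> cplV uM; apply: cplV => e e0.
have [||N hN] := @nondecreasing_bounded_cauchy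
    (fun n => \sum_(0 <= i < n) `|u i|) M e _ _ uM e0.
- move=> m n mn; rewrite [leRHS](big_cat_nat (n := m))//= lerDl.
  by rewrite sumr_ge0.
- by rewrite big_geq.
exists N => n Nn; apply: le_trans (hN _ Nn).
rewrite /series/= (big_cat_nat (n := N) (p := n))//=.
rewrite (big_cat_nat (n := N) (p := n) (F := fun i => `|u i|))//=.
by rewrite !(addrC (\sum_(0 <= i < N) _)) !addrK ler_norm_sum.
Qed.

(** The limit inherits the error bounds [r n] themselves; this is the form of completeness that
    Zabreiko's lemma consumes. *)
Lemma geometric_limit (V : normedModType F) (u : nat -> V) (r : nat -> F) (c : F) :
  seq_complete V -> (forall n, 0 <= r n <= `|c| / 2 ^+ n) ->
  (forall n m, (n <= m)%N -> `|u m - u n| <= r n) ->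
  exists l, forall n, `|l - u n| <= r n.
Proof.
move=> cplV rc ur.
have /cplV/cvg_ex[l ul] : forall e : F, 0 < e ->
    exists N, forall n, (N <= n)%N -> `|u n - u N| <= e.
  move=> e /(geometric_small c)[N hN]; exists N => n /ur/le_trans; apply.
  by have /andP[_ /le_trans] := rc N; apply.
exists l => n; apply: (@limit_norm_le _ (fun m => u m - u n)).
  by apply: cvgB => //; exact: cvg_cst.
by exists n => // m; exact: ur.
Qed.

End Limits.

(** * Real and complex scalars *)

Section ScalarFields.
Context (R : realType).

Lemma scalar_field_archimedean (b : base) :
  Num.archimedean_axiom (scalar_field R b).
Proof.
case: b => /= x.
  by exists (Num.bound `|x|); rewrite archi_boundP.
exists (Num.bound (complex.Re `|x|)).
have x_real : `|x| \is Num.real by rewrite ger0_real.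
rewrite -(RRe_real x_real) -(rmorph_nat (real_complex R)) ltcR.
by rewrite archi_boundP// -ler0c RRe_real.
Qed.

Lemma scalar_field_seq_complete (b : base) :
  seq_complete (scalar_field R b)^o.
Proof.
case: b => u hu; first exact: (@complete_seq_complete R R^o).
(* Real and imaginary parts are additive and dominated by the modulus, so each maps a Cauchy
   sequence to a Cauchy sequence of reals. *)
have part (f : R[i] -> R) : {morph f : x y / x - y} ->
    (forall z, (`|f z|)%:C%C <= `|z|) ->
    exists l : R, (f \o u) @ \oo --> (l : R^o).
  move=> fB f_le; apply/cvg_ex/(@complete_seq_complete R R^o) => e e0.
  have [|N hN] := hu e%:C%C; first by rewrite ltcR.
  exists N => n /hN; rewrite -lecR -fB => /(le_trans _); apply.
  exact: f_le.
have [|a ha] := part (@complex.Re R) _ (@normc_ge_Re R).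
  by move=> [? ?] [? ?].
have Im_le (z : R[i]) : (`|complex.Im z|)%:C%C <= `|z|.
  by rewrite normc_def lecR -sqrtr_sqr ler_wsqrtr// lerDr sqr_ge0.
have [|b hb] := part (@complex.Im R) _ Im_le; first by move=> [? ?] [? ?].
apply/cvg_ex; exists (a +i* b)%C; apply/cvgn_distP => e e0.
have e2_real : e / 2 \is Num.real by rewrite gtr0_real// divr_gt0.
have e2_gt0 : 0 < complex.Re (e / 2) by rewrite -ltcR RRe_real// [ltLHS]rmorph0 divr_gt0.
have /cvgn_distP/(_ _ e2_gt0)[N hN] := ha.
have /cvgn_distP/(_ _ e2_gt0)[N' hN'] := hb.
exists (maxn N N') => n; rewrite geq_max => /andP[/hN hRe /hN' hIm].
rewrite [X in `|X|]complexE (le_trans (ler_normD _ _))// (splitr e).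
have normC (x : R) : `|x%:C%C| = (`|x|)%:C%C.
  by rewrite normc_def/= expr0n/= addr0 sqrtr_sqr.
rewrite -(RRe_real e2_real) lerD//.
  by rewrite normC lecR; move: hRe => /=; case: (u n).
rewrite normrM normC normc_def/= expr0n expr1n add0r sqrtr1 mul1r lecR.
by move: hIm => /=; case: (u n).
Qed.

End ScalarFields.

(** * Zabreiko's lemma *)

(* [N r w] is read as [N w <= r] for a seminorm [N] that need not be defined
   as a function, e.g. a quotient norm. *)
Record gauge (F : numFieldType) (W : lmodType F) (N : F -> W -> Prop) : Prop :=
  Gauge {
    gauge_le : forall r s w, r <= s -> N r w -> N s w;
    gaugeD : forall r s v w, N r v -> N s w -> N (r + s) (v + w);
    gaugeZ : forall (c r : F) w, N r w -> N (`|c| * r) (c *: w) }.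

Section Baire.
Context {F : numFieldType}.
Context {W : lmodType F} {N Q : F -> W -> Prop}.
Context (gN : gauge N) (gQ : gauge Q).

Lemma gaugeB (P : F -> W -> Prop) r s v w :
  gauge P -> P r v -> P s w -> P (r + s) (v - w).
Proof.
move=> gP Pv Pw; apply: gaugeD => //; rewrite -scaleN1r.
by have := gaugeZ gP (-1) Pw; rewrite normrN1 mul1r.
Qed.

Lemma gauge_geometric_sum (P : F -> W -> Prop) (t : F) (u : nat -> W) :
  gauge P -> 0 <= t -> (forall n, P (t / 2 ^+ n) (u n)) ->
  forall n, P (t * 2) (\sum_(0 <= i < n) u i).
Proof.
move=> gP t0 hu n.
have pow0 m : (2 : F) ^+ m != 0 by rewrite expf_neq0// pnatr_eq0.
(* The exact value of the geometric partial sum makes the induction close. *)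
suff : P (t * 2 - t * 2 / 2 ^+ n) (\sum_(0 <= i < n) u i).
  apply: gauge_le => //.
  by rewrite lerBlDr lerDl divr_ge0 ?mulr_ge0 ?exprn_ge0.
elim: n => [|n ih].
  rewrite big_geq// expr0 divr1 subrr.
  by have := gaugeZ gP 0 (hu 0%N); rewrite normr0 mul0r scale0r.
rewrite big_nat_recr//=.
have -> : t * 2 - t * 2 / 2 ^+ n.+1 = t * 2 - t * 2 / 2 ^+ n + t / 2 ^+ n.
  by rewrite exprS; field; exact: pow0.
exact: gaugeD.
Qed.

Context (N_complete : forall (w : nat -> W) (r : nat -> F) c,
  (forall n, 0 <= r n <= `|c : F| / 2 ^+ n) ->
  (forall n m, (n <= m)%N -> N (r n) (w m - w n)) ->
  exists l, forall n, N (r n) (l - w n)).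
Context (N0 : N 0 0).
Context (Q_cover : forall w, exists n : nat, Q n%:R w).

(* [\bigcup_n [set w | Q n%:R w]] is everything, so by Baire's argument
   (shrinking balls) one of these sets is dense in some ball. *)
Lemma gauge_dense_ball :
  exists (n : nat) (w0 : W) (r : F), 0 < r /\
    forall w e, N r (w - w0) -> 0 < e ->
      exists a, Q n%:R a /\ N e (w - a).
Proof.
apply: contrapT => noball.
(* A pair is a center with a radius: the ball [q] has at most half the radius of [p], is centered
   within that half, and misses [Q n%:R]. The guard on [p.2] makes the relation total, so that a
   choice function exists. *)
pose shrinks (n : nat) (p q : W * F) :=
  0 < p.2 -> [/\ 0 < q.2, q.2 <= p.2 / 2, N (p.2 / 2) (q.1 - p.1) &
                 forall a, Q n%:R a -> ~ N q.2 (q.1 - a)].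
have step n (p : W * F) : exists q, shrinks n p q.
  case: p => w0 r; have [r0|nr0] := pselect (0 < r); last by exists (w0, r).
  apply: contrapT => /forallNP noq; apply: noball.
  exists n, w0, (r / 2); split=> [|w e wr e0]; first by rewrite divr_gt0.
  apply: contrapT => /forallNP noa.
  have : exists2 s : F, 0 < s & s <= r / 2 /\ s <= e.
    (* The product of two positive numbers over their sum lies below both. *)
    exists (r / 2 * e / (r / 2 + e)).
      by rewrite divr_gt0 ?mulr_gt0 ?addr_gt0 ?divr_gt0.
    have D0 : 0 < r / 2 + e by rewrite addr_gt0 ?divr_gt0.
    have r20 : 0 < r / 2 by rewrite divr_gt0.
    split; rewrite ler_pdivrMr//.
      by rewrite ler_wpM2l// ?lerDr ltW.
    by rewrite mulrC ler_wpM2l// ?lerDl ltW.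
  case=> s s0 [sr se]; apply: (noq (w, s)) => _; split=> //= a Qa Ns.
  by apply: (noa a); split=> //; exact: gauge_le Ns.
pose f (x : nat) (p : W * F) := sval (cid (step x p)).
have fP n p : shrinks n p (f n p) by exact: svalP (cid (step n p)).
pose x := fix x n := if n is m.+1 then f m (x m) else (0 : W, 1 : F).
have xS n : x n.+1 = f n (x n) by [].
have r_gt0 n : 0 < (x n).2.
  by elim: n => [|n ih]; [exact: ltr01|rewrite xS; have [] := fP n (x n) ih].
have x_step n : [/\ (x n.+1).2 <= (x n).2 / 2,
    N ((x n).2 / 2) ((x n.+1).1 - (x n).1) &
    forall a, Q n%:R a -> ~ N (x n.+1).2 ((x n.+1).1 - a)].
  by rewrite xS; have [] := fP n (x n) (r_gt0 n).
have r_le n : (x n).2 <= `|1| / 2 ^+ n.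
  rewrite normr1; elim: n => [|n ih]; first by rewrite expr0 divr1.
  have [rS _ _] := x_step n; rewrite (le_trans rS)// exprS invfM mulrCA mulrC.
  by rewrite ler_pM2l ?invr_gt0//; rewrite mul1r in ih.
have x_near n m : (n <= m)%N -> N (x n).2 ((x m).1 - (x n).1).
  move=> /subnK <-; move: (m - n)%N => k; elim: k n => [|k ih] n.
    by rewrite add0n subrr; apply: gauge_le N0 => //; exact: ltW.
  have [rS Nn _] := x_step n.
  have -> : (x (k.+1 + n)%N).1 - (x n).1 =
      ((x (k + n.+1)%N).1 - (x n.+1).1) + ((x n.+1).1 - (x n).1).
    by rewrite addrA subrK addSnnS.
  rewrite {1}(splitr (x n).2); apply: gaugeD => //.
  by apply: gauge_le (ih n.+1).
have [|l hl] := @N_complete (fun n => (x n).1) (fun n => (x n).2) 1 _ x_near.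
  by move=> n; rewrite r_le ltW.
(* The limit [l] lies in every ball, yet ball [n.+1] misses the set [Q n%:R] that contains it. *)
have [n Ql] := Q_cover l; have [_ _ /(_ l Ql)] := x_step n; apply.
have := gaugeZ gN (-1) (hl n.+1).
by rewrite normrN1 mul1r scaleN1r opprB.
Qed.

(** Countable subadditivity of [Q], asked for geometrically convergent series only. *)
Context (Q_closed : forall (u : nat -> W) (w : W) (s t : F),
  0 <= s -> 0 <= t ->
  (forall n, N (s / 2 ^+ n) (w - \sum_(0 <= i < n) u i)) ->
  (forall n, Q (t / 2 ^+ n) (u n)) -> Q (t * 2) w).

(* Zabreiko's lemma: by density every point of a ball is a point of [Q M] up to
   half the radius, and iterating on the errors writes it as a series. *)
Lemma gauge_dominated : exists2 C, 0 <= C & forall w, N 1 w -> Q C w.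
Proof.
have [n [w0 [r [r0 dense]]]] := gauge_dense_ball.
(* Density holds around [w0]. Writing [v] as [(v + w0) - w0] and approximating both terms moves the
   ball to the origin, at the cost of doubling the bound on [Q]. *)
pose M : F := n%:R + n%:R.
have M0 : 0 <= M by rewrite addr_ge0.
have approx v e : N r v -> 0 < e -> exists a, Q M a /\ N e (v - a).
  move=> Nv e0; have e20 : 0 < e / 2 by rewrite divr_gt0.
  have [||a [Qa Na]] := dense (v + w0) (e / 2); rewrite ?addrK//.
  have [||b [Qb Nb]] := dense w0 (e / 2); rewrite ?subrr//.
    by apply: gauge_le N0 => //; exact: ltW.
  exists (a - b); split; first exact: gaugeB.
  rewrite (splitr e).
  have -> : v - (a - b) = (v + w0 - a) - (w0 - b).
    by rewrite !opprB (addrAC v) (addrC b (- a)) (addrC b) !addrA addrK.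
  exact: gaugeB.
have pow_gt0 k : 0 < (2 : F) ^+ k by rewrite exprn_gt0.
have pow_norm k : `|2 ^+ k : F| = 2 ^+ k by rewrite gtr0_norm.
have approx_scaled k v : exists a, N (r / 2 ^+ k) v ->
    Q (M / 2 ^+ k) a /\ N (r / 2 ^+ k.+1) (v - a).
  have [Nv|] := pselect (N (r / 2 ^+ k) v); last by exists 0.
  have [||a [Qa Na]] := approx (2 ^+ k *: v) (r / 2).
  - have := gaugeZ gN (2 ^+ k) Nv.
    by rewrite pow_norm mulrC divfK ?gt_eqF.
  - by rewrite divr_gt0.
  exists ((2 ^+ k)^-1 *: a) => _; split.
    by have := gaugeZ gQ (2 ^+ k)^-1 Qa; rewrite normfV pow_norm mulrC.
  have := gaugeZ gN (2 ^+ k)^-1 Na.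
  rewrite normfV pow_norm scalerBr scalerA mulVf ?gt_eqF// scale1r.
  by rewrite exprS invfM mulrC mulrA.
have [a aP] := choice (fun kv : nat * W => approx_scaled kv.1 kv.2).
have Q_ball v : N r v -> Q (M * 2) v.
  (* [y k] is the error left after [k] corrections; its bound in [N] halves at each step, as does
     the bound in [Q] on the correction. *)
  move=> Nv; pose y := fix y k := if k is j.+1 then y j - a (j, y j) else v.
  have yN k : N (r / 2 ^+ k) (y k).
    elim: k => [|k ih]; first by rewrite expr0 divr1.
    by have [] := aP (k, y k) ih.
  have sumE k : v - \sum_(0 <= i < k) a (i, y i) = y k.
    elim: k => [|k ih]; first by rewrite big_geq// subr0.
    by rewrite big_nat_recr//= opprD addrA ih.
  apply: (Q_closed (u := fun k => a (k, y k)) (ltW r0) M0) => k.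
    by rewrite sumE.
  by have [] := aP (k, y k) (yN k).
exists (`|r^-1| * (M * 2)); first by rewrite !mulr_ge0.
move=> w Nw; have -> : w = r^-1 *: (r *: w).
  by rewrite scalerA mulVf ?scale1r// lt0r_neq0.
apply: (gaugeZ gQ); apply: Q_ball.
by have := gaugeZ gN r Nw; rewrite gtr0_norm// mulr1.
Qed.

End Baire.

(** * Weak* topologies and their continuous functionals *)

Section InitialTopology.

Lemma cvg_initial (S : choiceType) (T : topologicalType) (f : S -> T)
    (G : set_system S) (s : S) :
  Filter G -> f @ G --> f s -> G --> (s : initial_topology f).
Proof.
move=> FG fG U [_ [[V oV <-] Vfs /filterS]]; apply.
by apply: fG; exact: open_nbhs_nbhs.
Qed.

Lemma cvg_pointwise (I : Type) (T : topologicalType)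
    (G : set_system (I -> T)) (f : I -> T) :
  Filter G -> (forall i, (fun g => g i) @ G --> f i) ->
  G --> (f : {ptws I -> T}).
Proof. by move=> FG fG; apply/cvg_sup => i; exact: cvg_initial. Qed.

Lemma ptws_eval_continuous (I : Type) (T : topologicalType) (i : I) :
  continuous (fun f : {ptws I -> T} => f i).
Proof.
move=> f U Ui; have /cvg_sup/(_ i) : nbhs (f : {ptws I -> T}) --> f by [].
by apply; exact: (@initial_continuous _ _ (fun g : I -> T => g i)).
Qed.

Context {F : numFieldType}.

Lemma weakstar_cvg (X : normedModType F) (G : set_system (dual X)) (h : dual X) :
  Filter G -> (forall x, (fun g : dual X => g x) @ G --> h x) -> G --> h.
Proof.
move=> FG hG; apply: cvg_initial; apply: cvg_pointwise => x.
exact: hG.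
Qed.

Lemma weakstar_eval_continuous (X : normedModType F) (x : X) :
  continuous (fun h : dual X => h x).
Proof.
move=> h; apply: (@continuous_comp (dual X) {ptws X -> F^o} F^o
  (@dual_val F X) (fun f => f x)); last exact: ptws_eval_continuous.
exact: initial_continuous.
Qed.

Lemma ellinfty_cvg (G : set_system (ellinfty F)) (a : ellinfty F) :
  Filter G -> (forall g, (fun b => ell_pairing b g) @ G --> ell_pairing a g) -> G --> a.
Proof.
move=> FG aG; apply: cvg_initial; apply: cvg_pointwise => g.
exact: aG.
Qed.

Lemma ellinfty_pairing_continuous (g : ell1 F) :
  continuous (fun a : ellinfty F => ell_pairing a g).
Proof.
move=> a; apply: (@continuous_comp (ellinfty F) {ptws ell1 F -> F^o} F^o
  (@ell_pairing F) (fun f => f g)); last exact: ptws_eval_continuous.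
exact: initial_continuous.
Qed.

Lemma weakstar_continuous (T : topologicalType) (X : normedModType F)
    (f : T -> dual X) :
  (forall x, continuous (fun t => f t x)) -> continuous f.
Proof.
move=> f_cont t; apply: (weakstar_cvg (G := f @ t)) => x.
exact: f_cont.
Qed.

Lemma ellinfty_continuous (T : topologicalType) (f : T -> ellinfty F) :
  (forall g, continuous (fun t => ell_pairing (f t) g)) -> continuous f.
Proof.
move=> f_cont t; apply: (ellinfty_cvg (G := f @ t)) => g.
exact: f_cont.
Qed.

End InitialTopology.

Lemma linear_fun0 (R : pzRingType) (U V : lmodType R) (f : U -> V) :
  linear f -> f 0 = 0.
Proof.
move=> f_lin; apply: (addrI (f 0)).
by have := f_lin 1 0 0; rewrite !scale1r !addr0.
Qed.

Section WeakFunctionals.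
Context {F : numFieldType} {L X : lmodType F} {p : L -> X -> F^o}.
Context (p_linl : forall x, linear (p ^~ x)) (p_linr : forall l, linear (p l)).

Let pl0 x : p 0 x = 0.
Proof. exact: (linear_fun0 (p_linl x)). Qed.

Let pr0 l : p l 0 = 0.
Proof. exact: linear_fun0. Qed.

(** Induction on [s]: on the part of [E] killed by [x0], the remaining evaluations suffice, and a
    multiple of [x0] corrects the result on one further vector. The subspace [E] varies so that it
    can shrink. *)
Lemma functional_kernel_span (E : set L) (phi : L -> F^o) (s : seq X) :
  linear_subspace E ->
  (forall (c : F) u v, E u -> E v -> phi (c *: u + v) = c *: phi u + phi v) ->
  (forall l, E l -> (forall x, x \in s -> p l x = 0) -> phi l = 0) ->
  exists x, forall l, E l -> phi l = p l x.
Proof.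
move=> [E0 EZD]; have {}E0 : E 0 by rewrite inE in E0.
have {}EZD c u v : E u -> E v -> E (c *: u + v).
  by move=> Eu Ev; have := EZD c u v; rewrite !inE; apply.
move=> phi_lin; elim: s E E0 EZD phi_lin => [|x0 s ih] E E0 EZD phi_lin kphi.
  by exists 0 => l El; rewrite pr0 kphi.
have [| | | |x' hx'] := ih (E `&` [set l | p l x0 = 0]).
- by split=> //=; exact: pl0.
- move=> c u v [Eu /= pu] [Ev /= pv]; split=> /=; first exact: EZD.
  by rewrite p_linl pu pv scaler0 addr0.
- by move=> c u v [Eu _] [Ev _]; exact: phi_lin.
- move=> l [El /= pl] pls; apply: kphi => // x.
  by rewrite in_cons => /predU1P[->//|]; exact: pls.
have [all0|] := pselect (forall l, E l -> p l x0 = 0).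
  by exists x' => l El; apply: hx'; split=> //=; exact: all0.
move=> /existsNP[l0 /not_implyP[El0 /eqP pl0_neq0]].
(* The coefficient forces agreement at [l0]; adding the multiple [c] of [l0] moves any [l] into the
   kernel of [x0], where [x'] already works. *)
exists ((phi l0 - p l0 x') / p l0 x0 *: x0 + x') => l El.
pose c : F := - (p l x0 / p l0 x0).
have : phi (c *: l0 + l) = p (c *: l0 + l) x'.
  apply: hx'; split=> /=; first exact: EZD.
  by rewrite p_linl -[_ *: _]/(c * p l0 x0) /c mulNr divfK// addNr.
rewrite phi_lin// p_linl p_linr.
rewrite -[c *: phi l0]/(c * phi l0) -[c *: p l0 x']/(c * p l0 x').
rewrite -[_ *: p l x0]/((phi l0 - p l0 x') / p l0 x0 * p l x0) /c.
move: pl0_neq0.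
move: (p l0 x0 : F) (p l x0 : F) (phi l0 : F) (phi l : F) (p l x' : F) (p l0 x' : F).
move=> a b u v y z a0 e.
apply: (addrI (- (b / a) * u)); rewrite [LHS]e.
by field.
Qed.

(* Weak continuity at [0] bounds [phi] by finitely many evaluations, whose
   common kernel it must then contain. *)
Lemma weakly_continuous_functional (E : set L) (phi : L -> F^o) :
  linear_subspace E ->
  (forall (c : F) u v, E u -> E v -> phi (c *: u + v) = c *: phi u + phi v) ->
  (forall G : set_system L, Filter G ->
     (forall x, (fun l => p l x) @ G --> (0 : F^o)) ->
     G [set l | E l -> `|phi l| <= 1]) ->
  exists x, forall l, E l -> phi l = p l x.
Proof.
move=> Esub phi_lin phi_cont.
(* The weak neighborhood filter of [0]. The bound [1] is enough, since a smaller bound [e] is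
   obtained by rescaling the evaluation point by [e^-1]. *)
pose G : set_system L := [set U | exists s : seq X,
  forall l, (forall x, x \in s -> `|p l x| <= 1) -> U l].
have GF : Filter G.
  split; first by exists [::].
    move=> U V [s sU] [t tV]; exists (s ++ t) => l lst.
    by split; [apply: sU|apply: tV] => x xs; apply: lst; rewrite mem_cat xs ?orbT.
  by move=> U V UV [s sU]; exists s => l /sU; exact: UV.
have [|s sphi] := phi_cont G GF.
  move=> x; apply/cvgrPdist_le => e e0; exists [:: e^-1 *: x] => l /(_ (e^-1 *: x)).
  rewrite mem_head => /(_ isT).
  have := p_linr l e^-1 x 0; rewrite addr0 pr0 addr0 => ->.
  by rewrite sub0r normrN normrZ gtr0_norm ?invr_gt0// mulrC ler_pdivrMr// mul1r.
apply: (functional_kernel_span (s := s) Esub phi_lin) => l El ls.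
apply/eqP/negPn/negP => phi0.
have [E0 EZD] := Esub.
have phi00 : phi 0 = 0.
  rewrite inE in E0; have := phi_lin 1 0 0 E0 E0.
  by rewrite !scale1r !addr0 -{1}[phi 0]addr0 => /addrI.
(* This multiple of [l] is still killed by [s], but [phi] takes the value 2 there, against the bound
   1. *)
have El' : E (2 / phi l *: l).
  by have := EZD (2 / phi l) l 0; rewrite !inE addr0; apply=> //; rewrite inE in E0.
have phi2 : phi (2 / phi l *: l) = 2.
  rewrite -[_ *: l]addr0 phi_lin ?phi00 ?addr0//; last by rewrite inE in E0.
  by rewrite -[_ *: phi l]/(2 / phi l * phi l) divfK.
have : `|phi (2 / phi l *: l)| <= 1.
  apply: sphi El' => x xs; have := p_linl x (2 / phi l) l 0.
  by rewrite addr0 pl0 addr0 (ls x xs) scaler0 => ->; rewrite normr0.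
rewrite phi2 gtr0_norm//.
by rewrite (ler_nat F 2 1).
Qed.

End WeakFunctionals.

(** * The spaces of summable and of bounded sequences *)

Section SequenceSpaces.
Context {F : numFieldType}.
Context (archiF : Num.archimedean_axiom F) (cplF : seq_complete F^o).
Implicit Types (g : ell1 F) (a : ellinfty F).

Lemma ell1_bounded g : exists M, forall n, \sum_(0 <= i < n) `|g i| <= M.
Proof. by have /is_summableP := valP g. Qed.

Lemma bounded_seq_bounded (V : normedModType F) (k : bounded_seq V) :
  exists2 M, 0 <= M & forall j, `|k j| <= M.
Proof.
have /is_bounded_seqP[M kM] := valP k.
by exists M => //; exact: le_trans (kM 0%N).
Qed.

Lemma ell1_norm_cvg g : series (fun n => `|g n|) @ \oo --> (ell1_norm g : F^o).
Proof.
have [M gM] := ell1_bounded g.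
have : cvgn (series (fun n => `|g n|) : nat -> F^o).
  apply: (normal_series_cvg archiF (M := M)) => // n.
  by under eq_bigr do rewrite normr_id.
by [].
Qed.
Arguments ell1_norm_cvg : clear implicits.

Lemma ell1_norm_ge0 g : 0 <= ell1_norm g.
Proof.
have gcvg := ell1_norm_cvg g.
have : (fun n => `|series (fun n => `|g n|) n|) @ \oo --> (`|ell1_norm g : F^o| : F^o).
  exact: cvg_norm.
have -> : (fun n => `|series (fun n => `|g n|) n|) = series (fun n => `|g n|).
  by apply/funext => n; rewrite ger0_norm// sumr_ge0.
move=> /limn_eq; rewrite (limn_eq gcvg) => ->.
exact: normr_ge0.
Qed.

Lemma ell1_norm_le g (M : F) :
  (forall n, \sum_(0 <= i < n) `|g i| <= M) -> ell1_norm g <= M.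
Proof.
move=> gM; rewrite -[ell1_norm g]ger0_norm ?ell1_norm_ge0//.
apply: (limit_norm_le (ell1_norm_cvg g)); exists 0%N => // n _.
by rewrite ger0_norm ?gM// sumr_ge0.
Qed.

Lemma ell1_sum_le g n : \sum_(0 <= i < n) `|g i| <= ell1_norm g.
Proof.
apply/ler_addgt0Pr => e e0.
have /cvgn_distP/(_ _ e0)[N hN] := ell1_norm_cvg g.
have lS := hN (maxn n N) (leq_maxr _ _).
set S := series _ _ in lS.
have S0 : 0 <= S by rewrite sumr_ge0.
apply: (@le_trans _ _ S).
  rewrite /S /series/= (big_cat_nat (n := n) (p := maxn n N)) ?leq_maxl//=.
  by rewrite lerDl sumr_ge0.
rewrite -[S]ger0_norm// -[S](subKr (ell1_norm g)) (le_trans (ler_normB _ _))// lerD//.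
by rewrite ger0_norm// ell1_norm_ge0.
Qed.

Lemma ell1_series_cvg (V : normedModType F) (cplV : seq_complete V)
    (k : bounded_seq V) g :
  series (fun n => g n *: k n) @ \oo --> limn (series (fun n => g n *: k n)).
Proof.
have [M M0 kM] := bounded_seq_bounded k.
apply: (normal_series_cvg archiF (M := ell1_norm g * M)) => // n.
apply: (@le_trans _ _ (\sum_(0 <= i < n) `|g i| * M)).
  by apply: ler_sum => i _; rewrite normrZ ler_wpM2l.
by rewrite -mulr_suml ler_wpM2r// ell1_sum_le.
Qed.

Lemma ell1_series_le (V : normedModType F) (cplV : seq_complete V)
    (k : bounded_seq V) g (M : F) :
  0 <= M -> (forall j, `|k j| <= M) ->
  `|limn (series (fun n => g n *: k n))| <= M * ell1_norm g.
Proof.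
move=> M0 kM; apply: (limit_norm_le (@ell1_series_cvg V cplV k g)).
exists 0%N => // n _; rewrite (le_trans (ler_norm_sum _ _ _))//.
apply: (@le_trans _ _ (\sum_(0 <= i < n) `|g i| * M)).
  by apply: ler_sum => i _; rewrite normrZ ler_wpM2l.
by rewrite -mulr_suml mulrC ler_wpM2l// ell1_sum_le.
Qed.

Lemma ell_pairing_cvg a g :
  series (fun n => g n * a n) @ \oo --> ell_pairing a g.
Proof. exact: (@ell1_series_cvg F^o cplF a g). Qed.

Lemma ell_pairing_le a g (M : F) :
  0 <= M -> (forall j, `|a j| <= M) -> `|ell_pairing a g| <= M * ell1_norm g.
Proof. exact: (ell1_series_le cplF). Qed.

Lemma ell_pairing_linearl g : linear (fun a : ellinfty F => ell_pairing a g).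
Proof.
move=> c a b; apply: limn_eq.
have -> : series (fun n => g n * (c *: a + b : ellinfty F) n) =
    (fun n => c *: series (fun n => g n * a n) n + series (fun n => g n * b n) n).
  apply/funext => n; rewrite /series/= scaler_sumr -big_split/=.
  apply: eq_bigr => i _; rewrite -[LHS]/(g i * (c * a i + b i)).
  by rewrite mulrDr mulrCA.
by apply: cvgD; [apply: cvgZr|]; exact: ell_pairing_cvg.
Qed.

Lemma ell_pairing0 g : ell_pairing (0 : ellinfty F) g = 0.
Proof. exact: (linear_fun0 (ell_pairing_linearl g)). Qed.

Lemma ell_pairingD a (b : ellinfty F) g :
  ell_pairing (a + b : ellinfty F) g = ell_pairing a g + ell_pairing b g.
Proof. by have := ell_pairing_linearl g 1 a b; rewrite !scale1r. Qed.

Lemma ell_pairing_linearr a : linear (ell_pairing a).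
Proof.
move=> c g h; apply: limn_eq.
have -> : series (fun n => (c *: g + h : ell1 F) n * a n) =
    (fun n => c *: series (fun n => g n * a n) n + series (fun n => h n * a n) n).
  apply/funext => n; rewrite /series/= scaler_sumr -big_split/=.
  apply: eq_bigr => i _; rewrite -[LHS]/((c * g i + h i) * a i).
  by rewrite mulrDl -mulrA.
by apply: cvgD; [apply: cvgZr|]; exact: ell_pairing_cvg.
Qed.

Lemma series_supported (V : normedModType F) (u : nat -> V) n :
  (forall i, i != n -> u i = 0) -> limn (series u) = u n.
Proof.
move=> u0; apply: limn_eq; apply/cvgn_distP => e e0; exists n.+1 => m nm.
rewrite /series/= (bigD1_seq n) ?iota_uniq//=; last by rewrite mem_index_iota.
by rewrite big1 ?addr0 ?subrr ?normr0 ?ltW.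
Qed.

Lemma delta_sum_le (n m : nat) : \sum_(0 <= i < m) `|(i == n)%:R : F| <= 1.
Proof.
have [nm|mn] := ltnP n m.
  rewrite (bigD1_seq n) ?iota_uniq//=; last by rewrite mem_index_iota.
  rewrite eqxx normr1 big1 ?addr0// => i /negbTE ->.
  by rewrite normr0.
rewrite big_nat_cond big1 ?ler01// => i /andP[/andP[_ im] _].
by rewrite (ltn_eqF (leq_trans im mn)) normr0.
Qed.

Lemma delta_summable n : (fun i => (i == n)%:R : F^o) \in @is_summable F.
Proof. by apply/is_summableP; exists 1 => m; exact: delta_sum_le. Qed.

Definition ell1_delta n : ell1 F := Ell1 (delta_summable n).

Lemma delta_bounded n : (fun i => (i == n)%:R : F^o) \in @is_bounded_seq F F^o.
Proof.
apply/is_bounded_seqP; exists 1 => j.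
by case: eqP; rewrite ?normr1 ?normr0 ?ler01.
Qed.

Definition ellinfty_delta n : ellinfty F := BoundedSeq (delta_bounded n).

Lemma ell_pairing_delta g n : ell_pairing (ellinfty_delta n) g = g n.
Proof.
rewrite /ell_pairing (@series_supported F^o _ n)/= ?eqxx ?mulr1//.
by move=> i /negbTE ->; rewrite mulr0.
Qed.

Lemma ell_delta_pairing a n : ell_pairing a (ell1_delta n) = a n.
Proof.
rewrite /ell_pairing (@series_supported F^o _ n)/= ?eqxx ?mul1r//.
by move=> i /negbTE ->; rewrite mul0r.
Qed.

Lemma ell1_ext g (h : ell1 F) : (forall n, g n = h n) -> g = h.
Proof. by move=> gh; apply: val_inj; exact: funext. Qed.

Lemma ellinfty_ext a (b : ellinfty F) : (forall n, a n = b n) -> a = b.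
Proof. by move=> ab; apply: val_inj; exact: funext. Qed.

(* Division by zero makes the norming sequence [`|g j| / g j] vanish where [g] does. *)
Lemma ell1_norming g :
  exists2 a : ellinfty F, (forall j, `|a j| <= 1) & ell_pairing a g = ell1_norm g.
Proof.
have sgn_le j : `| `|g j| / g j| <= 1.
  rewrite normrM normfV normr_id; have [->|gj0] := eqVneq (g j) 0.
    by rewrite normr0 mul0r.
  by rewrite divff// normr_eq0.
have sgn_bounded : (fun j => `|g j| / g j : F^o) \in @is_bounded_seq F F^o.
  by apply/is_bounded_seqP; exists 1.
exists (BoundedSeq sgn_bounded) => //.
rewrite /ell_pairing /ell1_norm; congr (limn (series _)); apply/funext => n /=.
have [->|gn0] := eqVneq (g n) 0; first by rewrite mul0r normr0.
by rewrite mulrC divfK.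
Qed.

End SequenceSpaces.

(** * The operators [R_op] and [V_op] and their duality *)

Section Operators.
Context {F : numFieldType} {X : normedModType F}.
Context (archiF : Num.archimedean_axiom F) (cplF : seq_complete F^o).
Context (cplX : seq_complete X).
Implicit Types (k : bounded_seq X) (g : ell1 F) (h : dual X).

Lemma V_op_linear k : linear (V_op k).
Proof.
move=> c g g'; apply: limn_eq.
have -> : series (fun n => (c *: g + g' : ell1 F) n *: k n) =
    (fun n => c *: series (fun n => g n *: k n) n + series (fun n => g' n *: k n) n).
  apply/funext => n; rewrite /series/= scaler_sumr -big_split/=.
  apply: eq_bigr => i _; rewrite -[LHS]/((c * g i + g' i) *: k i).
  by rewrite scalerDl scalerA.
by apply: cvgD; [apply: cvgZr|]; exact: ell1_series_cvg.
Qed.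

Lemma V_opB k g g' : V_op k (g - g') = V_op k g - V_op k g'.
Proof.
by rewrite -scaleN1r addrC V_op_linear scaleN1r addrC.
Qed.

Lemma V_op_delta k n : V_op k (ell1_delta n) = k n.
Proof.
rewrite /V_op (series_supported (n := n))/= ?eqxx ?scale1r//.
by move=> i /negbTE ->; rewrite scale0r.
Qed.

Lemma V_op_le k : exists2 M, 0 <= M & forall g, `|V_op k g| <= M * ell1_norm g.
Proof.
have [M M0 kM] := bounded_seq_bounded k.
by exists M => // g; exact: ell1_series_le.
Qed.

Lemma dual_bound h : exists2 M, 0 <= M & forall x, `|h x| <= M * `|x|.
Proof.
have /linear_boundedP/pinfty_ex_gt0[M M0 hM] : bounded_near h (nbhs (0 : X)).
  exact/linear_bounded_continuous/dual_continuous.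
by exists M => //; exact: ltW.
Qed.

(** Continuity of [h] carries it through the series, so [R_op k] is the adjoint of [V_op k]. *)
Lemma dual_V_op k h g : h (V_op k g) = ell_pairing (R_op k h) g.
Proof.
apply/esym/limn_eq.
have -> : series (fun n => g n * (R_op k h) n) = h \o series (fun n => g n *: k n).
  by apply/funext => n; rewrite /series/= linear_sum;
    apply: eq_bigr => i _; rewrite linearZ.
apply: continuous_cvg; first exact: dual_continuous.
exact: ell1_series_cvg.
Qed.

Lemma R_op_linear k : linear (R_op k).
Proof. by move=> c h h'; exact: ellinfty_ext. Qed.

HB.instance Definition _ k :=
  GRing.isLinear.Build F (dual X) (ellinfty F) *:%R (R_op k) (R_op_linear k).

Lemma R_op_continuous k : continuous (R_op k).
Proof.
apply: ellinfty_continuous => g h; under eq_fun do rewrite -dual_V_op.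
exact: weakstar_eval_continuous.
Qed.

End Operators.

(** * Closed graph, open mapping and uniform boundedness *)

Section Gauges.
Context {F : numFieldType}.

Lemma norm_gauge (V : normedModType F) : gauge (fun (r : F) (v : V) => `|v| <= r).
Proof.
split=> [r s v rs /le_trans|r s v w vr ws|c r v vr]; first exact.
  by rewrite (le_trans (ler_normD _ _))// lerD.
by rewrite normrZ ler_wpM2l.
Qed.

(** Bounding partial sums expresses the norm of [ell1] without any limit. *)
Lemma ell1_gauge :
  gauge (fun (r : F) (g : ell1 F) => forall n, \sum_(0 <= i < n) `|g i| <= r).
Proof.
split=> [r s g rs gr n|r s g h gr hs n|c r g gr n].
- exact: le_trans (gr n) rs.
- apply: le_trans (lerD (gr n) (hs n)); rewrite -big_split/=.
  by apply: ler_sum => i _; exact: ler_normD.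
- apply: le_trans (ler_wpM2l (normr_ge0 c) (gr n)); rewrite mulr_sumr.
  by apply: ler_sum => i _; rewrite -normrM; exact: lexx.
Qed.

(** The supremum norm enters through its upper bounds, as suprema need not exist in [F]. *)
Lemma ellinfty_gauge :
  gauge (fun (r : F) (a : ellinfty F) => forall j, `|a j| <= r).
Proof.
split=> [r s a rs ar j|r s a b ar bs j|c r a ar j].
- exact: le_trans (ar j) rs.
- by apply: le_trans (lerD (ar j) (bs j)); exact: ler_normD.
- apply: le_trans (ler_wpM2l (normr_ge0 c) (ar j)); rewrite -normrM; exact: lexx.
Qed.

Lemma gauge_comp (W W' : lmodType F) (N : F -> W' -> Prop) (f : {linear W -> W'}) :
  gauge N -> gauge (fun r w => N r (f w)).
Proof.
move=> gN; split=> [r s w|r s v w Nv Nw|c r w Nw]; first exact: gauge_le.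
- by rewrite linearD; exact: gaugeD.
- by rewrite linearZ; exact: gaugeZ.
Qed.

End Gauges.

(** * Completeness of the sequence spaces *)

Section Completeness.
Context {F : numFieldType}.
Context (archiF : Num.archimedean_axiom F) (cplF : seq_complete F^o).

Lemma ellinfty_gauge_complete (w : nat -> ellinfty F) (r : nat -> F) (c : F) :
  (forall n, 0 <= r n <= `|c| / 2 ^+ n) ->
  (forall n m, (n <= m)%N -> forall j, `|(w m - w n) j| <= r n) ->
  exists l : ellinfty F, forall n j, `|(l - w n) j| <= r n.
Proof.
move=> rc wr.
have [l hl] := choice (fun j =>
  geometric_limit archiF cplF rc (fun n m nm => wr n m nm j)).
have [M M0 wM] := bounded_seq_bounded (w 0%N).
have l_bounded : l \in @is_bounded_seq F F^o.
  apply/is_bounded_seqP; exists (r 0%N + M) => j.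
  rewrite -[l j](subrK (w 0%N j)); apply: le_trans (ler_normD _ _) _.
  exact: lerD (hl j 0%N) (wM j).
by exists (BoundedSeq l_bounded) => n j; exact: hl.
Qed.

Lemma ell1_gauge_complete (w : nat -> ell1 F) (r : nat -> F) (c : F) :
  (forall n, 0 <= r n <= `|c| / 2 ^+ n) ->
  (forall n m, (n <= m)%N -> forall k, \sum_(0 <= i < k) `|(w m - w n) i| <= r n) ->
  exists l : ell1 F, forall n k, \sum_(0 <= i < k) `|(l - w n) i| <= r n.
Proof.
move=> rc wr.
have coord i n m : (n <= m)%N -> `|(w m : nat -> F^o) i - w n i| <= r n.
  move=> /wr/(_ i.+1); apply: le_trans.
  by rewrite big_nat_recr//= lerDr sumr_ge0.
have [l hl] := choice (fun i => geometric_limit archiF cplF rc (coord i)).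
have l_sum n k : \sum_(0 <= i < k) `|l i - w n i| <= r n.
  (* Compare with [w (n + m)]: each of the [k] coordinates is within [|c| / 2 ^+ m] of its limit,
     and this total error vanishes as [m] grows. *)
  apply: (le_geometric archiF (c := c *+ k)) => m.
  have -> : r n + `|c *+ k| / 2 ^+ m = \sum_(0 <= i < k) `|c| / 2 ^+ m + r n.
    by rewrite sumr_const_nat subn0 addrC normrMn mulrnAl.
  apply: le_trans (lerD (lexx _) (wr _ _ (leq_addr m n) k)).
  rewrite -big_split/=.
  apply: ler_sum => i _.
  rewrite -[l i](subrK (w (n + m)%N i)) -addrA (le_trans (ler_normD _ _))// lerD//.
  have [_ rnm] := andP (rc (n + m)%N).
  rewrite (le_trans (hl _ _))// (le_trans rnm)// ler_wpM2l//.
  by rewrite lef_pV2 ?posrE ?exprn_gt0// ler_eXn2l ?leq_addl// ltr1n.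
have [M wM] := ell1_bounded (w 0%N).
have l_summable : l \in @is_summable F.
  apply/is_summableP; exists (r 0%N + M) => k.
  apply: le_trans (lerD (l_sum 0%N k) (wM k)); rewrite -big_split/=.
  by apply: ler_sum => i _; rewrite -{1}[l i](subrK (w 0%N i)) ler_normD.
by exists (Ell1 l_summable) => n k; exact: l_sum.
Qed.

End Completeness.

Section OpenMapping.
Context {F : numFieldType} {X : normedModType F}.
Context (archiF : Num.archimedean_axiom F) (cplF : seq_complete F^o).
Context (cplX : seq_complete X).

Lemma norm_cover (x : X) : exists n : nat, `|x| <= n%:R.
Proof. by have [n /ltW] := archiF `|x|; rewrite normr_id; exists n. Qed.

Section CoordinatewiseContinuous.
Context (V : {linear X -> ell1 F}).
Context (V_coord : forall n, exists2 M, 0 <= M & forall x, `|V x n| <= M * `|x|).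

(** Zabreiko's lemma for the seminorm sending [x] to the norm of [V x]. Continuity of the
    coordinates, which encodes the closed graph, gives its countable subadditivity. *)
Lemma closed_graph : exists2 C, 0 <= C & forall x, ell1_norm (V x) <= C * `|x|.
Proof.
have [M /all_and2[M0 VM]] := choice (fun n => let: ex_intro2 M M0 hM := V_coord n in
  ex_intro (fun M => 0 <= M /\ forall x, `|V x n| <= M * `|x|) M (conj M0 hM)).
have VMk k x : \sum_(0 <= i < k) `|V x i| <= (\sum_(0 <= i < k) M i) * `|x|.
  by rewrite mulr_suml; apply: ler_sum => i _.
have := @gauge_dominated F X (fun r x => `|x| <= r)
  (fun r x => forall n, \sum_(0 <= i < n) `|V x i| <= r).
case.
- exact: norm_gauge.
- exact: (gauge_comp V ell1_gauge).
- by move=> w r c; exact: geometric_limit.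
- by rewrite normr0.
- move=> x; have [n] := archiF (ell1_norm (V x)).
  rewrite ger0_norm ?ell1_norm_ge0// => /ltW Vn; exists n => k.
  exact: le_trans (ell1_sum_le archiF cplF _ _) Vn.
- move=> u w s t s0 t0 us Vu k.
  have uV := gauge_geometric_sum (gauge_comp V ell1_gauge) t0 Vu.
  (* The first [k] coordinates of [V] are jointly bounded by the sum of the [M i], and the remainder
     after [m] terms has norm at most [s / 2 ^+ m]. *)
  apply: (le_geometric archiF (c := (\sum_(0 <= i < k) M i) * s)) => m.
  rewrite ger0_norm ?mulr_ge0 ?sumr_ge0// -mulrA.
  pose S := \sum_(0 <= i < m) u i.
  apply: (@le_trans _ _ (\sum_(0 <= i < k) `|V S i| + \sum_(0 <= i < k) `|V (w - S) i|)).
    rewrite -big_split/=; apply: ler_sum => i _.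
    by rewrite -{1}[w](subrK S) addrC linearD; exact: ler_normD.
  apply: lerD; first exact: uV.
  by apply: le_trans (VMk k _) _; rewrite ler_wpM2l ?sumr_ge0//; exact: us.
move=> C C0 VC; exists C => // x; have [->|x0] := eqVneq x 0.
  rewrite linear0 normr0 mulr0 ell1_norm_le// => n.
  by rewrite big1// => ? _; rewrite normr0.
apply: ell1_norm_le => // n.
have x_gt0 : 0 < `|x| by rewrite normr_gt0.
have /(gaugeZ (gauge_comp V ell1_gauge) `|x|) :
    forall n, \sum_(0 <= i < n) `|V (`|x|^-1 *: x) i| <= C.
  by apply: VC; rewrite normrZ normfV normr_id mulVf ?gt_eqF.
by rewrite normr_id scalerA divff ?gt_eqF// scale1r mulrC => /(_ n).
Qed.

Context (V_onto : forall g, exists x, V x = g).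

(** Zabreiko's lemma for the quotient norm: [Q r g] says that [g] has a preimage of norm at most
    [r]. Surjectivity gives the cover, and completeness of [X] sums the preimages. *)
Lemma open_mapping : exists2 C, 0 <= C &
  forall g : ell1 F, (forall n, \sum_(0 <= i < n) `|g i| <= 1) ->
    exists2 x, `|x| <= C & V x = g.
Proof.
apply: (@gauge_dominated F (ell1 F)
  (fun r (g : ell1 F) => forall n, \sum_(0 <= i < n) `|g i| <= r)
  (fun r g => exists2 x, `|x| <= r & V x = g)).
- exact: ell1_gauge.
- split=> [r s w rs [x xr Vx]|r s v w [x xr <-] [y ys <-]|c r w [x xr <-]].
  + by exists x => //; exact: le_trans rs.
  + by exists (x + y); rewrite ?linearD// (le_trans (ler_normD _ _))// lerD.
  + by exists (c *: x); rewrite ?linearZ// normrZ ler_wpM2l.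
- exact: ell1_gauge_complete.
- by move=> n; rewrite big1// => i _; rewrite normr0.
- move=> g; have [x <-] := V_onto g; have [n xn] := norm_cover x.
  by exists n, x.
- move=> u w s t s0 t0 us uQ.
  have {uQ}[x xP] := choice (fun n => let: ex_intro2 x xr Vx := uQ n in
    ex_intro (fun x => `|x| <= t / 2 ^+ n /\ V x = u n) x (conj xr Vx)).
  have x_le n := (xP n).1; have Vx n := (xP n).2.
  pose S m := \sum_(0 <= i < m) x i.
  (* The tail of [S] from [n] on is a geometric sum starting at [t / 2 ^+ n], hence at most twice
     that. *)
  have [|n m nm|l hl] := geometric_limit archiF cplX (u := S)
      (r := fun n => t / 2 ^+ n * 2) (c := t * 2).
  + move=> n; rewrite mulr_ge0 ?divr_ge0 ?exprn_ge0//=.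
    by rewrite ger0_norm ?mulr_ge0// mulrAC.
  + rewrite /S (big_cat_nat (n := n) (p := m))//= addrC addrK.
    rewrite -{1}[n]add0n big_addn.
    apply: (gauge_geometric_sum (norm_gauge X)).
      by rewrite divr_ge0 ?exprn_ge0.
    by move=> i; rewrite (le_trans (x_le _))// exprD invfM mulrCA mulrC.
  exists l.
    by have := hl 0%N; rewrite /S big_geq// subr0 expr0 divr1.
  apply: ell1_ext => j; apply/eqP; rewrite -subr_eq0 -normr_le0.
  have [M M0 VM] := V_coord j.
  apply: (le_geometric archiF (c := M * (t * 2) + s)) => n.
  have -> : V l j - w j = V (l - S n) j - (w - \sum_(0 <= i < n) u i) j.
    have -> : V (l - S n) = V l - \sum_(0 <= i < n) u i.
      by rewrite linearB linear_sum; under eq_bigr do rewrite Vx.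
    rewrite -[RHS]/(((V l - \sum_(0 <= i < n) u i) - (w - \sum_(0 <= i < n) u i)) j).
    by rewrite opprB addrA subrK.
  have c0 : 0 <= M * (t * 2) + s by rewrite addr_ge0 ?mulr_ge0.
  rewrite add0r (ger0_norm c0) mulrDl.
  apply: le_trans (ler_normB _ _) _; apply: lerD.
    apply: le_trans (VM _) _; rewrite -mulrA ler_wpM2l// mulrAC.
    exact: hl.
  have := us n j.+1; rewrite big_nat_recr//=; apply: le_trans.
  by rewrite lerDr sumr_ge0.
Qed.

End CoordinatewiseContinuous.

(** Interpolating [a] by [h] bounds the pairing of [a] with [g] by a multiple of the norm of
    [V_op k g]. Zabreiko's lemma makes the multiple uniform over the unit ball, and a norming [a]
    then recovers the norm of [g]. *)
Lemma interpolating_bounded_below (k : bounded_seq X) :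
  interpolating k -> V_bounded_below k.
Proof.
move=> k_int.
pose Q (r : F) (a : ellinfty F) := forall g, `|ell_pairing a g| <= r * `|V_op k g|.
have gQ : gauge Q.
  split=> [r s a rs ar g|r s a b ar bs g|c r a ar g].
  - by apply: le_trans (ar g) _; rewrite ler_wpM2r.
  - by rewrite ell_pairingD// mulrDl (le_trans (ler_normD _ _))// lerD.
  - have := ell_pairing_linearl archiF cplF g c a 0.
    by rewrite ell_pairing0// !addr0 => ->; rewrite normrM -mulrA ler_wpM2l.
have [||||||C C0 hC] := @gauge_dominated F (ellinfty F)
  (fun r (a : ellinfty F) => forall j, `|a j| <= r) Q.
- exact: ellinfty_gauge.
- exact: gQ.
- exact: ellinfty_gauge_complete.
- by move=> j; rewrite normr0.
- move=> a; have [h <-] := k_int a; have [M M0 hM] := dual_bound h.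
  have [n] := archiF M; rewrite ger0_norm// => /ltW Mn; exists n => g.
  rewrite -dual_V_op//; apply: le_trans (hM _) _.
  by rewrite ler_wpM2r.
- move=> u a s t s0 t0 us uQ g.
  apply: (le_geometric archiF (c := s * ell1_norm g)) => m.
  have snorm0 : 0 <= s * ell1_norm g by rewrite mulr_ge0// ell1_norm_ge0.
  rewrite (ger0_norm snorm0) -[a](subrK (\sum_(0 <= i < m) u i)) ell_pairingD// addrC.
  apply: le_trans (ler_normD _ _) _; apply: lerD.
    exact: (gauge_geometric_sum gQ t0 uQ).
  rewrite mulrAC; apply: ell_pairing_le => //.
  by rewrite divr_ge0 ?exprn_ge0.
(* [C] may be zero, hence the added 1. *)
exists (C + 1)^-1; first by rewrite invr_gt0 ltr_wpDl.
move=> g; have [a a1 ag] := ell1_norming g.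
rewrite mulrC ler_pdivrMr ?ltr_wpDl// mulrC.
rewrite -[ell1_norm g]ger0_norm ?ell1_norm_ge0// -ag (le_trans (hC a a1 g))//.
by rewrite ler_wpM2r// lerDl.
Qed.

(** The lower bound turns approximations of [x] in the range into a Cauchy sequence of preimages,
    which converges in [ell1]. *)
Lemma bounded_below_closed_range (k : bounded_seq X) :
  V_bounded_below k -> X_sub k `<=` range (V_op k).
Proof.
move=> [c c0 kc] x kx.
have approx n : exists g, `|x - V_op k g| <= 1 / 2 ^+ n.
  have e0 : 0 < 1 / 2 ^+ n :> F by rewrite divr_gt0 ?exprn_gt0.
  have [y [[g _ <-] xg]] := kx _ (nbhsx_ballx x _ e0).
  by exists g; move: xg; rewrite -ball_normE => /ltW.
have [g gx] := choice approx.
have [||l hl] := @ell1_gauge_complete F archiF cplF g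
  (fun n => (c^-1 * 2) / 2 ^+ n) (c^-1 * 2).
- have C0 : 0 <= c^-1 * 2 by rewrite mulr_ge0 ?invr_ge0 ?ltW.
  by move=> n; rewrite (ger0_norm C0) lexx andbT divr_ge0 ?exprn_ge0.
- move=> n m nm j; apply: le_trans (ell1_sum_le archiF cplF _ _) _.
  rewrite -[leRHS]mulrA ler_pdivlMl//.
  apply: le_trans (kc _) _.
  have -> : V_op k (g m - g n) = (x - V_op k (g n)) - (x - V_op k (g m)).
    by rewrite V_opB// opprB [RHS]addrC addrA subrK.
  apply: le_trans (ler_normB _ _) _.
  have -> : (2 : F) / 2 ^+ n = 1 / 2 ^+ n + 1 / 2 ^+ n by rewrite -mulrDl.
  apply: lerD => //; apply: le_trans (gx m) _.
  by rewrite ler_pM2l// lef_pV2 ?posrE ?exprn_gt0// ler_eXn2l ?ltr1n.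
exists l => //; apply/esym/eqP; rewrite -subr_eq0 -normr_le0.
have [M M0 VM] := V_op_le archiF cplF cplX k.
apply: (le_geometric archiF (c := 1 + M * (c^-1 * 2))) => n.
have c20 : 0 <= c^-1 * 2 by rewrite mulr_ge0 ?invr_ge0 ?ltW.
have C0 : 0 <= 1 + M * (c^-1 * 2) by rewrite addr_ge0 ?ler01// mulr_ge0.
rewrite add0r (ger0_norm C0) mulrDl.
have -> : x - V_op k l = (x - V_op k (g n)) - V_op k (l - g n).
  by rewrite V_opB// opprB addrA subrK.
apply: le_trans (ler_normB _ _) _; apply: lerD => //.
apply: le_trans (VM _) _; rewrite -mulrA ler_wpM2l//.
exact: (ell1_norm_le archiF cplF).
Qed.

End OpenMapping.

(** * Interpolating sequences *)

Section InterpolatingSequences.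
Context {F : numFieldType} {X : normedModType F}.
Context (archiF : Num.archimedean_axiom F) (cplF : seq_complete F^o).
Context (cplX : seq_complete X).

Lemma near0_norm_le1 (T : Type) (G : set_system T) (f : T -> F^o) :
  Filter G -> f @ G --> (0 : F^o) -> G [set t | `|f t| <= 1].
Proof.
move=> FG /cvgrPdist_le/(_ 1 ltr01); apply: filterS => t /=.
by rewrite sub0r normrN.
Qed.

Lemma ellinfty_functional_pairing (phi : ellinfty F -> F^o) :
  linear phi -> continuous phi -> exists g, forall a, phi a = ell_pairing a g.
Proof.
move=> phi_lin phi_cont.
have [|||||g hg] := @weakly_continuous_functional F (ellinfty F) (ell1 F)
  (@ell_pairing F) _ _ setT phi.
- by move=> g; exact: ell_pairing_linearl.
- by move=> a; exact: ell_pairing_linearr.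
- by split=> [|c u v _ _]; rewrite inE.
- by move=> c u v _ _; exact: phi_lin.
- move=> G GF G0.
  have G_cvg : G --> (0 : ellinfty F).
    by apply: ellinfty_cvg => g; rewrite ell_pairing0//; exact: G0.
  have phi0 : phi @ G --> (0 : F^o).
    by rewrite -(linear_fun0 phi_lin); apply: cvg_trans (phi_cont 0); exact: cvg_app.
  by apply: filterS (near0_norm_le1 GF phi0) => l /= ? _.
by exists g => a; exact: hg.
Qed.

Lemma dual_functional_eval (E : set (dual X)) (phi : dual X -> F^o) :
  linear_subspace E ->
  (forall (c : F) u v, E u -> E v -> phi (c *: u + v) = c *: phi u + phi v) ->
  {within E, continuous phi} -> exists x, forall h, E h -> phi h = h x.
Proof.
move=> Esub phi_lin phi_cont.
have [E0 _] := Esub; rewrite inE in E0.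
apply: (weakly_continuous_functional (p := fun (h : dual X) x => h x)) => //.
- by move=> h; exact: dual_linear.
move=> G GF G0.
have G_cvg : G --> (0 : dual X) by apply: weakstar_cvg => x; exact: G0.
have phi0 : phi 0 = 0.
  apply: (addrI (phi 0)); have := phi_lin 1 0 0 E0 E0.
  by rewrite !scale1r !addr0.
(* Continuity is available along [E] only; the trace filter turns it into the implication from [E l]
   that is required. *)
have phi_cvg : phi @ within E (nbhs (0 : dual X)) --> (0 : F^o).
  by rewrite -phi0; move/subspace_continuousP : phi_cont; apply.
by apply: G_cvg; exact: (near0_norm_le1 _ phi_cvg).
Qed.

(** * From an embedding of [ellinfty] to an interpolating sequence *)

Section Embedding.
Context (E : set (dual X)) (T : {linear ellinfty F -> dual X}).
Context (Esub : linear_subspace E) (T_cont : continuous T) (TE : range T = E).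
Context (S : dual X -> ellinfty F) (TK : cancel T S).
Context (S_cont : {within E, continuous S}).

(** For fixed [x], evaluating [T a] at [x] is weak*-continuous in [a], so it is the pairing with
    some [V x]; testing on unit vectors shows that [V] is linear. *)
Lemma preadjoint_exists :
  exists V : {linear X -> ell1 F}, forall a x, T a x = ell_pairing a (V x).
Proof.
have evalT x : exists g, forall a, T a x = ell_pairing a g.
  apply: ellinfty_functional_pairing => [c a b|a]; first by rewrite linearP.
  apply: (@continuous_comp (ellinfty F) (dual X) F^o T (fun h => h x)).
    exact: T_cont.
  exact: weakstar_eval_continuous.
have [V hV] := choice evalT.
have V_lin : linear V.
  move=> c x y; apply: ell1_ext => n.
  rewrite -[RHS]/(c * V x n + V y n) -!ell_pairing_delta -!hV.
  by rewrite linearP.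
pose V' : {linear X -> ell1 F} :=
  HB.pack V (GRing.isLinear.Build F X (ell1 F) *:%R V V_lin).
by exists V' => a x; exact: hV.
Qed.

Context (V : {linear X -> ell1 F}).
Context (TV : forall a x, T a x = ell_pairing a (V x)).

Lemma preadjoint_coord n : exists2 M, 0 <= M & forall x, `|V x n| <= M * `|x|.
Proof.
have [M M0 hM] := dual_bound (T (ellinfty_delta n)).
by exists M => // x; rewrite -ell_pairing_delta -TV.
Qed.

(** Continuity of the inverse [S] makes the pairing of [S h] with [g] an evaluation [h x] on [E]; at
    [h = T a] this says that [V x] and [g] pair equally with [a]. *)
Lemma preadjoint_onto g : exists x, V x = g.
Proof.
have [||x hx] := @dual_functional_eval E (fun h => ell_pairing (S h) g) Esub.
- move=> c u v; rewrite -TE => -[a _ <-] [b _ <-].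
  by rewrite -linearP !TK; exact: ell_pairing_linearl.
- apply/subspace_continuousP => h Eh.
  apply: (@cvg_comp _ _ _ S (fun a => ell_pairing a g) _ (nbhs (S h))).
    by move/subspace_continuousP : S_cont; apply.
  exact: ellinfty_pairing_continuous.
exists x; apply: ell1_ext => n.
rewrite -!ell_pairing_delta -TV -hx ?TK// -TE.
by exists (ellinfty_delta n).
Qed.

(** Surjectivity alone would lift the unit vectors; the open mapping principle keeps the lifts
    bounded. *)
Lemma embedding_lift :
  exists K : bounded_seq X, forall j, V (K j) = ell1_delta j.
Proof.
have [C C0 lift] := open_mapping archiF cplF cplX preadjoint_coord preadjoint_onto.
have lift_delta j : exists x, `|x| <= C /\ V x = ell1_delta j.
  have [|x xC Vx] := lift (ell1_delta j); first by move=> n; exact: delta_sum_le.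
  by exists x.
have [k hk] := choice lift_delta.
have k_bounded : k \in @is_bounded_seq F X.
  by apply/is_bounded_seqP; exists C => j; have [] := hk j.
by exists (BoundedSeq k_bounded) => j; have [] := hk j.
Qed.

Context (K : bounded_seq X) (VK : forall j, V (K j) = ell1_delta j).

Lemma embedding_retraction a : R_op K (T a) = a.
Proof.
by apply: ellinfty_ext => j; rewrite -[LHS]/(T a (K j)) TV VK ell_delta_pairing.
Qed.

Lemma preadjoint_V_op g : V (V_op K g) = g.
Proof.
apply: ell1_ext => n.
by rewrite -!ell_pairing_delta -TV dual_V_op// embedding_retraction.
Qed.

(** [V] is a left inverse of [V_op K], and it is bounded by the closed graph principle. *)
Lemma embedding_bounded_below : V_bounded_below K.
Proof.
have [C C0 VC] := closed_graph archiF cplF cplX preadjoint_coord.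
exists (C + 1)^-1; first by rewrite invr_gt0 ltr_wpDl.
move=> g; rewrite mulrC ler_pdivrMr ?ltr_wpDl// mulrC -{1}[g]preadjoint_V_op.
by rewrite (le_trans (VC _))// ler_wpM2r// lerDl.
Qed.

Lemma embedding_weakstar_complemented : weakstar_complemented E.
Proof.
have P_lin : linear (T \o R_op K) by move=> c h h'; rewrite /= !linearP.
pose P : {linear dual X -> dual X} :=
  HB.pack (T \o R_op K)
    (GRing.isLinear.Build F (dual X) (dual X) *:%R (T \o R_op K) P_lin).
exists P; last first.
  rewrite -TE; apply/seteqP; split=> [_ [h _ <-]|_ [a _ <-]].
    by exists (R_op K h).
  by exists (T a) => //=; rewrite embedding_retraction.
split=> [h|h]; last by rewrite /= embedding_retraction.
by apply: continuous_comp; [exact: R_op_continuous|exact: T_cont].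
Qed.

Lemma embedding_complemented : complemented (X_sub K).
Proof.
have P_lin : linear (V_op K \o V).
  by move=> c x y; rewrite /= linearP V_op_linear.
pose P : {linear X -> X} :=
  HB.pack (V_op K \o V) (GRing.isLinear.Build F X X *:%R (V_op K \o V) P_lin).
have [C C0 VC] := closed_graph archiF cplF cplX preadjoint_coord.
have [M M0 KM] := V_op_le archiF cplF cplX K.
have P_cont : continuous P.
  apply/linear_bounded_continuous/linear_boundedP.
  exists (M * C); split; first by rewrite ger0_real ?mulr_ge0.
  move=> r Mr x; apply: le_trans (KM _) _.
  apply: (@le_trans _ _ (M * C * `|x|)); first by rewrite -mulrA ler_wpM2l.
  by rewrite ler_wpM2r// ltW.
exists P; first by split=> // x; rewrite /= preadjoint_V_op.
apply/seteqP; split=> [_ [x _ <-]|x].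
  by apply: subset_closure; exists (V x).
move=> /(bounded_below_closed_range archiF cplF cplX embedding_bounded_below)[g _ <-].
by exists (V_op K g) => //=; rewrite preadjoint_V_op.
Qed.

End Embedding.

(** * From a complement of [X_sub K] to the annihilator *)

Section Complement.
Context (K : bounded_seq X) (Y : set X).
Context (K_int : interpolating K) (XY : topological_direct_sum (X_sub K) Y).

Lemma annihilator_weakstar_homeomorphic :
  exists T : {linear ellinfty F -> dual X}, weakstar_homeomorphism T (annihilator Y).
Proof.
have [A_sub B_sub AB [p [q [p_cont q_cont pq]]]] := XY.
have [A0 AZD] := A_sub; have [B0 BZD] := B_sub.
have {}A0 : X_sub K 0 by rewrite inE in A0.
have {}B0 : Y 0 by rewrite inE in B0.
have {}AZD c x y : X_sub K x -> X_sub K y -> X_sub K (c *: x + y).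
  by move=> Ax Ay; have := AZD c x y; rewrite !inE; apply.
have {}BZD c x y : Y x -> Y y -> Y (c *: x + y).
  by move=> Bx By; have := BZD c x y; rewrite !inE; apply.
(* Trivial intersection makes the decomposition unique; linearity of [p] and its values on [X_sub K]
   and [Y] follow. *)
have p_unique x y z : X_sub K y -> Y z -> x = y + z -> p x = y.
  move=> Ay Bz xyz; have [Ap Bq xpq] := pq x.
  have pyzq : p x - y = z - q x.
    by apply/eqP; rewrite subr_eq addrAC eq_sym subr_eq -xpq xyz addrC.
  have : (X_sub K `&` Y) (p x - y).
    split; first by rewrite addrC -scaleN1r; exact: AZD.
    by rewrite pyzq addrC -scaleN1r; exact: BZD.
  by rewrite AB => /eqP; rewrite subr_eq0 => /eqP.
have p_lin : linear p.
  move=> c x y; have [Ax Bx xE] := pq x; have [Ay By yE] := pq y.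
  apply: (p_unique _ _ (c *: q x + q y)); [exact: AZD|exact: BZD|].
  by rewrite {1}xE {1}yE scalerDr addrACA.
have pK x : exists g, V_op K g = p x.
  have K_below := interpolating_bounded_below archiF cplF cplX K_int.
  have [/(bounded_below_closed_range archiF cplF cplX K_below)[g _ gx] _ _] := pq x.
  by exists g.
have [G hG] := choice pK.
have pid j : p (K j) = K j.
  apply: (p_unique _ _ 0) => //; last by rewrite addr0.
  by apply: subset_closure; exists (ell1_delta j) => //; exact: V_op_delta.
have pY y : Y y -> p y = 0.
  by move=> Yy; apply: (p_unique _ _ y) => //; rewrite add0r.
(* If [h] interpolates [a], duality identifies the pairing of [a] with [G x] as [h (p x)], which is
   linear and continuous in [x]. *)
have dual_p a : exists h : dual X, forall x, h x = ell_pairing a (G x).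
  have [h ha] := K_int a.
  have hp_dual : (fun x => h (p x)) \in @is_dual F X.
    apply/asboolP; split=> [c x y|x]; first by rewrite p_lin linearP.
    by apply: continuous_comp; [exact: p_cont|exact: dual_continuous].
  by exists (Dual hp_dual) => x; rewrite /= -hG dual_V_op// ha.
have [T hT] := choice dual_p.
have T_lin : linear T.
  move=> c a b; apply: val_inj; apply/funext => x.
  by rewrite -[RHS]/(c *: T a x + T b x) /= !hT; exact: ell_pairing_linearl.
pose T' : {linear ellinfty F -> dual X} :=
  HB.pack T (GRing.isLinear.Build F (ellinfty F) (dual X) *:%R T T_lin).
have RT a : R_op K (T a) = a.
  apply: ellinfty_ext => j; have [h ha] := K_int a.
  by rewrite -[LHS]/(T a (K j)) hT -ha -dual_V_op// hG pid.
exists T'; split.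
- apply: weakstar_continuous => x; under eq_fun do rewrite hT.
  exact: ellinfty_pairing_continuous.
- apply/seteqP; split=> [_ [a _ <-] y Yy|h hY].
    have [h ha] := K_int a.
    by rewrite /= hT -ha -dual_V_op// hG pY// linear0.
  (* The functional obtained from [R_op K h] is [h] composed with [p], and this is [h] because [h]
     kills the component [q x] in [Y]. *)
  exists (R_op K h) => //; apply: val_inj; apply/funext => x.
  rewrite /= hT -dual_V_op// hG.
  have [_ Yq xpq] := pq x.
  have -> : h x = h (p x) + h (q x) by rewrite {1}xpq linearD.
  by rewrite (hY _ Yq) addr0.
exists (R_op K); first exact: RT.
by apply: continuous_subspaceT; exact: R_op_continuous.
Qed.

End Complement.
End InterpolatingSequences.

Theorem theorem3p13 (R : realType) (b : base)
    (X : completeNormedModType (scalar_field R b)) :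
  (forall (E : set (dual X))
      (T : {linear ellinfty (scalar_field R b) -> dual X}),
    linear_subspace E ->
    weakstar_homeomorphism T E ->
    exists K : bounded_seq X,
      ([/\ interpolating K,
           forall a, R_op K (T a) = a &
           V_bounded_below K])
      /\ (weakstar_complemented E /\ complemented (X_sub K)))
  /\
  (forall (K : bounded_seq X) (Y : set X),
    interpolating K ->
    complemented (X_sub K) ->
    topological_direct_sum (X_sub K) Y ->
    exists T : {linear ellinfty (scalar_field R b) -> dual X},
      weakstar_homeomorphism T (annihilator Y)).
Proof.
have archiF := @scalar_field_archimedean R b.
have cplF := @scalar_field_seq_complete R b.
have cplX := @complete_seq_complete _ X.
split=> [E T Esub [T_cont TE [S TK S_cont]]|K Y K_int _ XY]; last first.
  exact: annihilator_weakstar_homeomorphic XY.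
have [V TV] := preadjoint_exists archiF cplF T_cont.
have [K VK] := embedding_lift archiF cplF cplX Esub TE TK S_cont TV.
exists K; split; split.
- by move=> a; exists (T a); exact: embedding_retraction TV K VK a.
- exact: embedding_retraction TV K VK.
- exact: embedding_bounded_below TV K VK.
- exact: embedding_weakstar_complemented TV K VK.
- exact: embedding_complemented TV K VK.
Qed.
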